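(* Let $\nu\in\mathcal{P}_2(\mathbb{R}^d)$, $\delta\in(0,1)$ and, for $\mu\in\mathcal{P}_2(\mathbb{R}^d)$, $$\Phi_\delta(\mu)=\sup_{\mu'\in\mathcal{P}_2(\mathbb{R}^d)}\Big\{W_2^2(\mu',\nu)-\frac1\delta W_2^2(\mu',\mu)\Big\}.$$ Then for every $\mu\in\mathcal{P}_2(\mathbb{R}^d)$, $$W_2^2(\mu,\nu)\le\Phi_\delta(\mu)\le\frac1{1-\delta}W_2^2(\mu,\nu).$$
   Context: $\mathcal{P}_2(\mathbb{R}^d)$ is the set of Borel probability measures on $\mathbb{R}^d$ with finite second moment, with the Wasserstein distance $W_2^2(\mu,\nu)=\inf_{\gamma\in\Pi(\mu,\nu)}\int|x-y|^2\gamma(dx,dy)$, where $\Pi(\mu,\nu)$ is the set of couplings of $\mu$ and $\nu$. *)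

(* Defs.v *)
From HB Require Import structures.
From mathcomp Require Import all_boot all_order all_algebra.
From mathcomp Require Import all_classical all_reals all_analysis.

Set Implicit Arguments.
Unset Strict Implicit.
Unset Printing Implicit Defensive.

Import Order.TTheory GRing.Theory Num.Theory.
Import numFieldNormedType.Exports.

Local Open Scope classical_set_scope.
Local Open Scope ring_scope.

(* R^d with its Borel sigma-algebra: 'rV[R]_d carries the product topology,
   which is the usual one.  The product [borelRd R d * borelRd R d] carries the
   product sigma-algebra, which is the Borel one since R^d is second countable. *)
Notation borelRd R d := (g_sigma_algebraType (@open 'rV[R]_d)).

(* The library norm `|x| on 'rV[R]_d is the sup norm, hence this definition. *)
Definition sqnorm (R : realType) (d : nat) (x : 'rV[R]_d) : R :=
  \sum_(i < d) x ord0 i ^+ 2.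

Definition P2 (R : realType) (d : nat) : set (probability (borelRd R d) R) :=
  [set mu : probability (borelRd R d) R |
    (\int[mu]_x (sqnorm (x : 'rV[R]_d))%:E < +oo)%E].

(* Marginals are compared on measurable sets only: a measure is a function on
   all sets, with unspecified values outside the sigma-algebra. *)
Definition couplings (R : realType) (d : nat)
    (mu nu : probability (borelRd R d) R) :
    set (probability (borelRd R d * borelRd R d)%type R) :=
  [set gamma : probability (borelRd R d * borelRd R d)%type R |
    (forall A : set (borelRd R d), measurable A ->
       pushforward gamma fst A = mu A) /\
    (forall B : set (borelRd R d), measurable B ->
       pushforward gamma snd B = nu B)].

(* The squared distance W_2^2, with values in \bar R. *)
Definition W2sq (R : realType) (d : nat)
    (mu nu : probability (borelRd R d) R) : \bar R :=
  ereal_inf [set (\int[gamma]_z (sqnorm ((z.1 : 'rV[R]_d) - z.2))%:E)%E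
            | gamma in couplings mu nu].

(* On P2 both terms are finite, so the difference is never of the
   form +oo - +oo. *)
Definition Phi (R : realType) (d : nat) (delta : R)
    (nu mu : probability (borelRd R d) R) : \bar R :=
  ereal_sup [set (W2sq mu' nu - (delta^-1)%:E * W2sq mu' mu)%E
            | mu' in @P2 R d].

(* Main.v *)
From HB Require Import structures.
Require Import Defs.
From mathcomp Require Import all_boot all_order all_algebra.
From mathcomp Require Import all_classical all_reals all_analysis measurable_realfun.
From mathcomp Require Import ring lra.
Import Order.TTheory GRing.Theory Num.Theory.
Import numFieldNormedType.Exports.
Local Open Scope classical_set_scope.
Local Open Scope ring_scope.

(** For the lower bound take mu' = mu.  The upper bound is the weighted triangle
    inequality W(mu1,mu3) <= W(mu1,mu2) / delta + W(mu2,mu3) / (1 - delta) for the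
    squared distances W.  The middle marginals of two couplings g1 and g2 are glued
    only approximately, which avoids disintegration: cut the space into countably
    many small cubes A_n and, on pairs ((x, y), (y', z)), take the measure
      \sum_n mu2(A_n)^-1 (g1 \x g2) restricted to {y in A_n, y' in A_n}.
    Its marginals are exactly g1 and g2, while y and y' always lie in the same
    cube, and the resulting error vanishes with the mesh. *)

(** * Gluing two probability measures along matching partitions *)

Lemma block_coupling_exists {d1 d2} {T1 : measurableType d1}
    {T2 : measurableType d2} {R : realType}
    (P1 : probability T1 R) (P2 : probability T2 R)
    (A : nat -> set T1) (B : nat -> set T2) :
  (forall n, measurable (A n)) -> (forall n, measurable (B n)) ->
  trivIset setT A -> trivIset setT B ->
  \bigcup_n A n = setT -> \bigcup_n B n = setT ->
  (forall n, P1 (A n) = P2 (B n)) ->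
  exists Q : probability (T1 * T2)%type R,
    [/\ forall X, measurable X -> Q (X `*` setT) = P1 X,
        forall Y, measurable Y -> Q (setT `*` Y) = P2 Y
      & Q (~` \bigcup_n (A n `*` B n)) = 0%E].
Proof.
move=> mA mB tA tB cA cB AB.
have mE n : measurable (A n `*` B n) by exact: measurableX.
(* Since $0^{-1} = 0$ here, a block of mass zero gets weight zero, and [m n] needs no case
   distinction. *)
have c_ge0 n : 0 <= (fine (P1 (A n)))^-1 by rewrite invr_ge0 fine_ge0.
pose m n := mscale (NngNum (c_ge0 n)) (mrestr (P1 \x P2)%E (mE n)).
have mXE n X Y : measurable X -> measurable Y -> m n (X `*` Y) =
    (((fine (P1 (A n)))^-1)%:E * (P1 (X `&` A n) * P2 (Y `&` B n)))%E.
  move=> mX mY; rewrite /m /mscale /= /mrestr -setXI product_measure1E//;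
    exact: measurableI.
(* The weight cancels one factor of block mass. On a null block the bound forces $x = 0$, so the
   identity survives there too. *)
have cK n (x : \bar R) : (0 <= x <= P1 (A n))%E ->
    (((fine (P1 (A n)))^-1)%:E * (x * P1 (A n)))%E = x.
  move=> /andP[x0 xA]; have [A0|A0] := eqVneq (P1 (A n)) 0%E.
    move: xA; rewrite A0 => xA; rewrite mule0 mule0.
    by apply/esym/eqP; rewrite eq_le xA x0.
  have PA := fin_num_measure P1 _ (mA n).
  rewrite muleCA; suff -> : ((fine (P1 (A n)))^-1%:E * P1 (A n) = 1)%E.
    by rewrite mule1.
  by rewrite -[X in (_ * X)%E](fineK PA) -EFinM mulVf// fine_eq0.
have sub n X : measurable X -> (0 <= P1 (X `&` A n) <= P1 (A n))%E.
  move=> mX; rewrite measure_ge0/= le_measure ?inE//; exact: measurableI.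
have sub2 n X : measurable X -> (0 <= P2 (X `&` B n) <= P1 (A n))%E.
  move=> mX; rewrite measure_ge0/= AB le_measure ?inE//; exact: measurableI.
have tot d (T : measurableType d) (P : probability T R) (C : nat -> set T) X :
    (forall n, measurable (C n)) -> trivIset setT C -> \bigcup_n C n = setT ->
    measurable X -> (\sum_(0 <= n <oo) P (X `&` C n))%E = P X.
  move=> mC tC cC mX; rewrite -[in RHS](setIT X) -cC setI_bigcupr.
  rewrite measure_bigcup//.
  - by apply: eq_eseriesl => n; rewrite in_setT.
  - by move=> n _; exact: measurableI.
  - exact: trivIset_setIl.
have QX X : measurable X -> mseries m 0 (X `*` setT) = P1 X.
  move=> mX; rewrite -(tot _ _ P1 A X)//; apply: eq_eseriesr => n _.
  by rewrite [LHS](mXE n X setT)// setTI -AB cK// sub.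
have QY Y : measurable Y -> mseries m 0 (setT `*` Y) = P2 Y.
  move=> mY; rewrite -(tot _ _ P2 B Y)//; apply: eq_eseriesr => n _.
  by rewrite [LHS](mXE n setT Y)// setTI [(P1 _ * _)%E]muleC cK// sub2.
have Q1 : mseries m 0 setT = 1%E by rewrite -setXTT QX// probability_setT.
pose Qm := Measure_isProbability.Build _ _ _ (mseries m 0) Q1.
pose Q : probability _ _ := HB.pack (mseries m 0) Qm.
exists Q; split=> //.
(* Each summand is carried by its own block, hence none charges the complement of their union. *)
rewrite /Q /= /mseries eseries0// => n _ _.
rewrite /m /= /mscale /= /mrestr.
rewrite (_ : _ `&` _ = set0) ?measure0 ?mule0//.
by rewrite -subset0 => z [+ Ez]; apply; exists n.
Qed.

(** * Measurability of the cost, and partitions of space into small cubes *)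

Lemma measurable_coord {R : realType} {d : nat} (i : 'I_d) :
  measurable_fun setT (fun x : borelRd R d => (x : 'rV[R]_d) ord0 i).
Proof.
apply: (measurability _ (RGenOpens.measurableE R)).
move=> _ [_ [a [b ->] <-]]; rewrite setTI.
apply: sub_sigma_algebra; apply: open_comp; last exact: interval_open.
by move=> x _; exact: coord_continuous.
Qed.

Lemma measurable_sqnorm {R : realType} {d : nat} :
  measurable_fun setT (fun z : borelRd R d * borelRd R d =>
    (sqnorm ((z.1 : 'rV[R]_d) - z.2))%:E).
Proof.
apply/measurable_EFinP; rewrite /sqnorm.
apply: measurable_sum => i.
under eq_fun do rewrite !mxE.
apply: measurable_funX; apply: measurable_funB.
- exact: (measurableT_comp (measurable_coord i) measurable_fst).
- exact: (measurableT_comp (measurable_coord i) measurable_snd).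
Qed.

Lemma sqnorm_ge0 {R : realType} {d : nat} (x : 'rV[R]_d) : 0 <= sqnorm x.
Proof. by apply: sumr_ge0 => i _; exact: sqr_ge0. Qed.

(** The cells are half-open cubes of side [c^-1]. Each is determined by an integer vector of floors,
    and [pickle] turns these vectors into natural indices. *)
Lemma fine_partition {R : realType} {d : nat} (e : R) : 0 < e ->
  exists A : nat -> set (borelRd R d),
    [/\ forall n, measurable (A n), trivIset setT A, \bigcup_n A n = setT
      & forall n x y, A n x -> A n y -> sqnorm ((x : 'rV[R]_d) - y) <= e].
Proof.
(* The part $d/e$ gives $d/c \le e$. The summand 1 gives $c \ge 1$, hence $c^{-2} \le c^{-1}$, and
   keeps [c] positive when $d = 0$. *)
move=> e0; pose c : R := 1 + d%:R / e.
have c1 : 1 <= c by rewrite lerDl divr_ge0// ltW.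
pose q (x : 'rV[R]_d) : 'rV[int]_d := \row_i Num.floor (x ord0 i * c).
exists (fun n => [set x : borelRd R d | pickle (q x) = n]); split.
(* An index that encodes no vector has an empty cell. *)
- move=> n; case En : (@pickle_inv 'rV[int]_d n) => [v|]; last first.
    rewrite (_ : [set _ | _] = set0)// -subset0 => x /= xn.
    by move: En; rewrite -xn pickleK_inv.
  have nv : pickle v = n by move: (@pickle_invK 'rV[int]_d n); rewrite En.
  rewrite (_ : [set _ | _] = \bigcap_(i in [set: 'I_d])
      (fun x : borelRd R d => (x : 'rV[R]_d) ord0 i) @^-1`
        [set t | (v ord0 i)%:~R <= t * c < (v ord0 i + 1)%:~R]).
    apply: fin_bigcap_measurable; first exact: finite_finset.
    move=> i _; rewrite -[X in measurable X]setTI; apply: measurable_coord => //.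
    rewrite (_ : [set _ | _] = `[(v ord0 i)%:~R / c, (v ord0 i + 1)%:~R / c[%classic);
      first exact: measurable_itv.
    have c0 : 0 < c by lra.
    by apply/seteqP; split=> t /=; rewrite in_itv/= ler_pdivrMr// ltr_pdivlMr.
  apply/seteqP; split=> [x /= xn i _|x /= H] /=.
    have <- : q x = v by apply: (pcan_inj pickleK); rewrite xn nv.
    by rewrite mxE floor_itv.
  rewrite -nv; congr pickle; apply/rowP => i; rewrite mxE.
  by apply: floor_def; exact: H.
- by move=> i j _ _ [x [/= <- <-]].
- by rewrite -subTset => x _; exists (pickle (q x)).
- move=> n x y /= xn yn.
  have /rowP qxy : q x = q y by apply: (pcan_inj pickleK); rewrite xn yn.
  have c0 : 0 < c by lra.
  apply: (@le_trans _ _ (\sum_(i < d) c^-1)).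
    apply: ler_sum => i _; rewrite !mxE.
    have := qxy i; rewrite !mxE => fxy.
    have /andP[x1 x2] := floor_itv ((x : 'rV[R]_d) ord0 i * c).
    have /andP[y1 y2] := floor_itv ((y : 'rV[R]_d) ord0 i * c).
    move: x1 x2 y1 y2; rewrite fxy intrD.
    move: ((x : 'rV[R]_d) ord0 i) ((y : 'rV[R]_d) ord0 i) => s t s1 s2 t1 t2.
    have st : `|s - t| <= c^-1.
      by rewrite -[c^-1]mul1r ler_pdivlMr// -[c in X in X <= _](gtr0_norm c0)
        -normrM ler_norml mulrBl; apply/andP; split; lra.
    rewrite -real_normK ?num_real// expr2.
    apply: (@le_trans _ _ (c^-1 * 1)); last by rewrite mulr1.
    by apply: ler_pM => //; apply: (le_trans st); rewrite invf_le1.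
  rewrite sumr_const card_ord -mulr_natl ler_pdivrMr//.
  by rewrite /c mulrDr mulrCA divff ?gt_eqF// mulr1; lra.
Qed.

(** * Image measures and change of variables *)

Lemma pushforward_probability {d1 d2} {T1 : measurableType d1}
    {T2 : measurableType d2} {R : realType} (P : probability T1 R)
    (f : T1 -> T2) :
  measurable_fun setT f ->
  exists Q : probability T2 R, Q = pushforward P f :> (set T2 -> \bar R).
Proof. by move=> mf; exists (distribution P (mfun_Sub (mem_set mf))). Qed.

(** [Q] agrees with the image of [P] on measurable sets only, so the change of variables is made for
    a true pushforward [Q'], and the integral is then transferred to [Q]. *)
Lemma integral_image_probability {d1 d2} {T1 : measurableType d1}
    {T2 : measurableType d2} {R : realType} (P : probability T1 R)
    (Q : probability T2 R) (f : T1 -> T2) (k : T2 -> \bar R) :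
  measurable_fun setT f -> (forall X, measurable X -> P (f @^-1` X) = Q X) ->
  measurable_fun setT k -> (forall x, (0 <= k x)%E) ->
  (\int[P]_x k (f x) = \int[Q]_x k x)%E.
Proof.
move=> mf PQ mk k0; have [Q' Q'E] := pushforward_probability P _ mf.
transitivity (\int[Q']_x k x)%E.
  by rewrite Q'E ge0_integral_pushforward.
by apply: eq_measure_integral => X mX _; rewrite [LHS](congr1 (@^~ X) Q'E) [LHS]PQ.
Qed.

(** * Pointwise inequalities for the quadratic cost *)

Lemma sqr_add3_le {R : realType} (delta eta u v w : R) :
  0 < delta -> delta < 1 -> 0 < eta ->
  (u + w + v) ^+ 2 <=
    (1 + eta) * (delta^-1 * u ^+ 2 + (1 - delta)^-1 * v ^+ 2) +
    (1 + eta^-1) * w ^+ 2.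
Proof.
move=> d0 d1 e0; have d1' : 0 < 1 - delta by lra.
(* Convexity of the square with weights [delta] and [1 - delta]; the gap is a perfect square. *)
have uv : (u + v) ^+ 2 <= delta^-1 * u ^+ 2 + (1 - delta)^-1 * v ^+ 2.
  rewrite -subr_ge0 (_ : _ - _ =
    ((1 - delta) * u - delta * v) ^+ 2 / (delta * (1 - delta))).
    by rewrite divr_ge0 ?sqr_ge0// ltW// mulr_gt0.
  by field; rewrite !gt_eqF.
(* Young's inequality splits off [w], the future gluing error. A small [eta] leaves the main term
   almost unchanged, at the price of a large factor on [w]. *)
apply: (@le_trans _ _ ((1 + eta) * (u + v) ^+ 2 + (1 + eta^-1) * w ^+ 2)).
  rewrite -subr_ge0 (_ : _ - _ = (eta * (u + v) - w) ^+ 2 / eta).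
    by rewrite divr_ge0 ?sqr_ge0// ltW.
  by field; rewrite gt_eqF.
by rewrite lerD2r ler_wpM2l// addr_ge0// ltW.
Qed.

Lemma sqnorm_sub_le {R : realType} {d : nat} (delta eta : R)
    (x y y' z : 'rV[R]_d) :
  0 < delta -> delta < 1 -> 0 < eta ->
  sqnorm (x - z) <=
    (1 + eta) * (delta^-1 * sqnorm (x - y) + (1 - delta)^-1 * sqnorm (y' - z)) +
    (1 + eta^-1) * sqnorm (y - y').
Proof.
move=> d0 d1 e0; rewrite /sqnorm !mulr_sumr -big_split/= mulr_sumr -big_split/=.
apply: ler_sum => i _; rewrite !mxE.
rewrite (_ : x ord0 i - z ord0 i = (x ord0 i - y ord0 i) +
  (y ord0 i - y' ord0 i) + (y' ord0 i - z ord0 i)); last by ring.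
exact: sqr_add3_le.
Qed.

(** * The squared Wasserstein distance and its weighted triangle inequality *)

Lemma W2sq_ge0 {R : realType} {d : nat} (mu nu : probability (borelRd R d) R) :
  (0 <= W2sq mu nu)%E.
Proof.
apply: le_ereal_inf_tmp => _ [g _ <-]; apply: integral_ge0 => z _.
by rewrite lee_fin sqnorm_ge0.
Qed.

Lemma W2sq_self {R : realType} {d : nat} (mu : probability (borelRd R d) R) :
  W2sq mu mu = 0%E.
Proof.
apply/eqP; rewrite eq_le W2sq_ge0 andbT; apply: ereal_inf_lbound.
(* The image of [mu] under the diagonal map is a coupling of cost zero. *)
have mdiag : measurable_fun setT (fun x : borelRd R d => (x, x)).
  by apply/measurable_fun_pair; exact: measurable_id.
have [g gE] := pushforward_probability mu _ mdiag.
exists g.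
  by split=> A mA; rewrite /pushforward gE.
rewrite gE ge0_integral_pushforward//.
- by apply: integral0_eq => x _ /=; rewrite subrr /sqnorm big1// => i _;
    rewrite mxE expr0n.
- exact: measurable_sqnorm.
- by move=> z _; rewrite lee_fin sqnorm_ge0.
Qed.

Lemma W2sq_le_cost {R : realType} {d : nat} (delta : R)
    (mu1 mu2 mu3 : probability (borelRd R d) R)
    (g1 g2 : probability (borelRd R d * borelRd R d)%type R) :
  0 < delta -> delta < 1 -> couplings mu1 mu2 g1 -> couplings mu2 mu3 g2 ->
  (W2sq mu1 mu3 <=
    delta^-1%:E * \int[g1]_z (sqnorm ((z.1 : 'rV[R]_d) - z.2))%:E +
    (1 - delta)^-1%:E * \int[g2]_z (sqnorm ((z.1 : 'rV[R]_d) - z.2))%:E)%E.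
Proof.
move=> d0 d1 [g11 g12] [g21 g22].
have di0 : 0 <= delta^-1 by rewrite invr_ge0 ltW.
have di1 : 0 <= (1 - delta)^-1 by rewrite invr_ge0; lra.
pose s (z : borelRd R d * borelRd R d) : \bar R :=
  (sqnorm ((z.1 : 'rV[R]_d) - z.2))%:E.
have ms : measurable_fun setT s by exact: measurable_sqnorm.
have s0 z : (0 <= s z)%E by rewrite lee_fin sqnorm_ge0.
have mpre1 X : measurable X ->
    measurable (@fst (borelRd R d) (borelRd R d) @^-1` X).
  by move=> mX; rewrite -[X in measurable X]setTI; exact: measurable_fst.
have mpre2 X : measurable X ->
    measurable (@snd (borelRd R d) (borelRd R d) @^-1` X).
  by move=> mX; rewrite -[X in measurable X]setTI; exact: measurable_snd.
set C := (X in (_ <= X)%E).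
(* The mesh is chosen so that [sqnorm] is at most [eta ^+ 2] within a cell; the factor $1 + 1/\eta$
   turns this into the error $\eta^2 + \eta$. *)
have approx eta : 0 < eta ->
    (W2sq mu1 mu3 <= (1 + eta)%:E * C + (eta ^+ 2 + eta)%:E)%E.
  move=> e0; have [A [mA tA cA Ae]] := @fine_partition R d _ (exprn_gt0 2 e0).
  have [Q [Q1 Q2 Q0]] : exists Q : probability
      ((borelRd R d * borelRd R d) * (borelRd R d * borelRd R d))%type R,
    [/\ forall X, measurable X -> Q (X `*` setT) = g1 X,
        forall Y, measurable Y -> Q (setT `*` Y) = g2 Y
      & Q (~` \bigcup_n ((snd @^-1` A n) `*` (fst @^-1` A n))) = 0%E].
    apply: block_coupling_exists.
    - by move=> n; exact: mpre2.
    - by move=> n; exact: mpre1.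
    - by move=> i j _ _ [p [pi pj]]; apply: (tA i j) => //; exists p.2.
    - by move=> i j _ _ [p [pi pj]]; apply: (tA i j) => //; exists p.1.
    - by rewrite -preimage_bigcup cA preimage_setT.
    - by rewrite -preimage_bigcup cA preimage_setT.
    (* Matching blocks have equal mass because [g1] and [g2] share the marginal [mu2]. *)
    - by move=> n; rewrite [LHS]g12// [RHS]g21.
  (* Keeping only the outer points of $((x, y), (y', z))$ yields a coupling of [mu1] and [mu3]. *)
  pose h (p : (borelRd R d * borelRd R d) * (borelRd R d * borelRd R d)) :=
    (p.1.1, p.2.2).
  have mh : measurable_fun setT h.
    apply/measurable_fun_pair.
      exact: (measurableT_comp measurable_fst measurable_fst).
    exact: (measurableT_comp measurable_snd measurable_snd).
  have [g gE] := pushforward_probability Q _ mh.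
  have gc : couplings mu1 mu3 g.
    split=> X mX; rewrite /pushforward gE /pushforward.
      rewrite -g11// -[RHS]Q1.
        by congr (Q _); apply/seteqP; split=> -[[? ?] [? ?]] //= [].
      exact: mpre1.
    rewrite -g22// -[RHS]Q2.
      by congr (Q _); apply/seteqP; split=> -[[? ?] [? ?]] //= [].
    exact: mpre2.
  apply: (@le_trans _ _ (\int[g]_z s z)%E).
    by apply: ereal_inf_lbound; exists g.
  rewrite gE ge0_integral_pushforward// preimage_setT.
  have I1 : (\int[Q]_p s p.1 = \int[g1]_z s z)%E.
    apply: integral_image_probability => // X mX; rewrite -Q1//.
    by congr (Q _); apply/seteqP; split=> -[? ?] //= [].
  have I2 : (\int[Q]_p s p.2 = \int[g2]_z s z)%E.
    apply: integral_image_probability => // X mX; rewrite -Q2//.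
    by congr (Q _); apply/seteqP; split=> -[? ?] //= [].
  have ms1 : measurable_fun setT (fun p : (borelRd R d * borelRd R d) *
      (borelRd R d * borelRd R d) => (delta^-1%:E * s p.1)%E).
    apply: measurable_funeM; exact: (measurableT_comp ms measurable_fst).
  have ms2 : measurable_fun setT (fun p : (borelRd R d * borelRd R d) *
      (borelRd R d * borelRd R d) => ((1 - delta)^-1%:E * s p.2)%E).
    apply: measurable_funeM; exact: (measurableT_comp ms measurable_snd).
  have b0 p : (0 <= (1 + eta)%:E *
      (delta^-1%:E * s p.1 + (1 - delta)^-1%:E * s p.2))%E.
    apply: mule_ge0; first by rewrite lee_fin; lra.
    by apply: adde_ge0; exact: mule_ge0.
  have mb : measurable_fun setT (fun p : (borelRd R d * borelRd R d) *
      (borelRd R d * borelRd R d) => ((1 + eta)%:E *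
      (delta^-1%:E * s p.1 + (1 - delta)^-1%:E * s p.2))%E).
    by apply: measurable_funeM; exact: emeasurable_funD.
  have ee : 0 <= eta ^+ 2 + eta by rewrite addr_ge0 ?sqr_ge0// ltW.
  apply: (@le_trans _ _ (\int[Q]_p ((1 + eta)%:E *
      (delta^-1%:E * s p.1 + (1 - delta)^-1%:E * s p.2) +
      (eta ^+ 2 + eta)%:E))%E).
    apply: ae_ge0_le_integral => //.
    - by move=> p _; exact: s0.
    - exact: (measurableT_comp ms mh).
    - by move=> p _; apply: adde_ge0; [exact: b0|rewrite lee_fin].
    - exact: emeasurable_funD.
    (* The pointwise bound is needed only where $y$ and $y'$ share a cell; the remaining pairs are
       [Q]-null. *)
    exists (~` \bigcup_n ((snd @^-1` A n) `*` (fst @^-1` A n))); split=> //.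
      apply: measurableC; apply: bigcup_measurable => n _; apply: measurableX.
        exact: mpre2.
      exact: mpre1.
    apply: subsetC => p [n _ [/= pn1 pn2]] _.
    rewrite /s /h /= lee_fin.
    apply: (le_trans (sqnorm_sub_le _ _ _ p.1.2 p.2.1 _ d0 d1 e0)).
    rewrite lerD2l.
    apply: (@le_trans _ _ ((1 + eta^-1) * eta ^+ 2)).
      apply: ler_wpM2l; last exact: (Ae n _ _ pn1 pn2).
      by rewrite addr_ge0// invr_ge0 ltW.
    rewrite (_ : _ * _ = eta ^+ 2 + eta)//; field; exact: lt0r_neq0.
  rewrite ge0_integralD//; [|by move=> p _; exact: b0].
  rewrite integral_cst// [X in (_ + _ * X)%E](@probability_setT _ _ _ Q) mule1.
  rewrite ge0_integralZl_EFin//; last 3 first.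
  - by move=> p _; rewrite adde_ge0// mule_ge0.
  - exact: emeasurable_funD.
  - by lra.
  rewrite ge0_integralD//; [|by move=> p _; rewrite mule_ge0..].
  rewrite ge0_integralZl_EFin//; last exact: (measurableT_comp ms measurable_fst).
  rewrite ge0_integralZl_EFin//; last exact: (measurableT_comp ms measurable_snd).
  by rewrite I1 I2.
have C0 : (0 <= C)%E.
  by rewrite adde_ge0// mule_ge0// integral_ge0// => z _; exact: s0.
move: C C0 approx => [c||]// c0 approx; last by rewrite leey.
rewrite lee_fin in c0; apply/lee_addgt0Pr => e e0.
(* With $\eta = e/(c+2+e) < 1$, the excess $\eta c + \eta^2 + \eta$ is at most $\eta(c+2) \le e$. *)
have k0 : 0 < c + 2 + e by lra.
have eta0 : 0 < e / (c + 2 + e) by rewrite divr_gt0.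
apply: (le_trans (approx _ eta0)); move: eta0.
have etak : e / (c + 2 + e) * (c + 2 + e) = e by rewrite mulfVK// gt_eqF.
move: (e / (c + 2 + e)) etak => eta etak eta0.
rewrite -EFinM -!EFinD lee_fin; nra.
Qed.

(** Near-optimal couplings are inserted into [W2sq_le_cost]. If a distance on the right is infinite,
    so is the whole right-hand side. *)
Lemma W2sq_weighted_triangle {R : realType} {d : nat} (delta : R)
    (mu1 mu2 mu3 : probability (borelRd R d) R) :
  0 < delta -> delta < 1 ->
  (W2sq mu1 mu3 <=
    delta^-1%:E * W2sq mu1 mu2 + (1 - delta)^-1%:E * W2sq mu2 mu3)%E.
Proof.
move=> d0 d1.
have di0 : 0 < delta^-1 by rewrite invr_gt0.
have di1 : 0 < (1 - delta)^-1 by rewrite invr_gt0; lra.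
have notNy (a : R) mu nu : 0 < a -> (a%:E * @W2sq R d mu nu)%E != -oo%E.
  move=> a0; rewrite -ltNye (lt_le_trans (ltNyr 0))//.
  by rewrite mule_ge0 ?W2sq_ge0// lee_fin ltW.
have [W1oo|W1] := eqVneq (W2sq mu1 mu2) +oo%E.
  rewrite W1oo gt0_muley ?lte_fin// addye ?leey//.
  exact: notNy.
have [W2oo|W2] := eqVneq (W2sq mu2 mu3) +oo%E.
  rewrite W2oo gt0_muley ?lte_fin// addey ?leey//.
  exact: notNy.
have F1 : W2sq mu1 mu2 \is a fin_num by rewrite ge0_fin_numE ?ltey ?W2sq_ge0.
have F2 : W2sq mu2 mu3 \is a fin_num by rewrite ge0_fin_numE ?ltey ?W2sq_ge0.
apply/lee_addgt0Pr => e e0.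
(* The slack [e'] is scaled so that the two weighted errors add up to exactly [e]. *)
have k0 : 0 < delta^-1 + (1 - delta)^-1 by rewrite addr_gt0.
have e'0 : 0 < e / (delta^-1 + (1 - delta)^-1) by rewrite divr_gt0.
have e'K : e / (delta^-1 + (1 - delta)^-1) * (delta^-1 + (1 - delta)^-1) = e.
  by rewrite mulfVK// gt_eqF.
move: (e / _) e'0 e'K => e' e'0 e'K.
have [_ [g1 c1 <-] /ltW l1] := lb_ereal_inf_adherent e'0 F1.
have [_ [g2 c2 <-] /ltW l2] := lb_ereal_inf_adherent e'0 F2.
apply: (le_trans (W2sq_le_cost delta _ _ _ _ _ d0 d1 c1 c2)).
apply: (@le_trans _ _ (delta^-1%:E *
    (W2sq mu1 mu2 + e'%:E) +
  (1 - delta)^-1%:E *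
    (W2sq mu2 mu3 + e'%:E))%E).
  by apply: leeD; rewrite lee_wpmul2l// ?lee_fin ?ltW.
rewrite -(fineK F1) -(fineK F2) -!EFinD lee_fin.
lra.
Qed.

Theorem mainTheorem4 (R : realType) (d : nat)
    (nu : probability (borelRd R d) R) (hnu : P2 nu)
    (delta : R) (hdelta0 : 0 < delta) (hdelta1 : delta < 1)
    (mu : probability (borelRd R d) R) (hmu : P2 mu) :
  (W2sq mu nu <= Phi delta nu mu)%E /\
  (Phi delta nu mu <= ((1 - delta)^-1)%:E * W2sq mu nu)%E.
Proof.
split.
  apply: ereal_sup_ubound; exists mu => //.
  by rewrite W2sq_self mule0 sube0.
apply: ge_ereal_sup => _ [mu' _ <-].
have di0 : 0 < delta^-1 by rewrite invr_gt0.
(* In the infinite case the difference is [-oo] by the convention that adding [-oo] always gives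
   [-oo]. Otherwise the subtracted term is finite and moves to the other side, leaving the triangle
   inequality through [mu]. *)
have [W1oo|W1] := eqVneq (W2sq mu' mu) +oo%E.
  by rewrite W1oo gt0_muley ?lte_fin//= addeNy leNye.
rewrite leeBlDl.
  exact: W2sq_weighted_triangle.
by rewrite fin_numM// ge0_fin_numE ?ltey ?W2sq_ge0.
Qed.
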